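(* Let $\{x_k\}_{k\ge 0}$ be a sequence generated by the inexact SQA algorithm described in the context, with any one of the four line searches LS1, LS2, LS3, LS4. Suppose there exists $\underline\alpha>0$ such that $\alpha_k\ge\underline\alpha$ for all $k$, and that $$R_0:=\sup_{x:\,F(x)\le F(x_0)}\|x-P_{\mathcal{X}}(x)\|$$ is finite. Then $F(x_k)-F^\ast=\mathcal{O}(k^{-1})$ as $k\to\infty$. Furthermore, if $\operatorname{dist}(x_k,\mathcal{X})\to0$, then $F(x_k)-F^\ast=o(k^{-1})$ as $k\to\infty$.
   Context: Setting. $\mathcal{H}$ is a real Hilbert space with norm $\|\cdot\|$ and inner product $\langle\cdot,\cdot\rangle$. $F:=f+g$, where $f,g:\mathcal{H}\to(-\infty,\infty]$ are proper lower semicontinuous convex functions with $\operatorname{dom} g\subset\operatorname{int}(\operatorname{dom} f)$ (so $\operatorname{dom}F=\operatorname{dom}g$). $f$ is Fréchet differentiable on an open set containing $\operatorname{dom} g$, and $\nabla f$ is continuous on $\operatorname{dom} g$. The set $\mathcal{X}$ of minimizers of $F$ is nonempty and $F^\ast:=\min F\in\mathbb{R}$. $P_{\mathcal{X}}$ is the metric projection onto the nonempty closed convex set $\mathcal{X}$, and $\operatorname{dist}(x,\mathcal{X})=\inf_{y\in\mathcal{X}}\|x-y\|$. Metrics. $H_k:\mathcal{H}\to\mathcal{H}$ ($k\ge0$) are positive self-adjoint operators, $\langle\cdot,\cdot\rangle_k=\langle\cdot,H_k\cdot\rangle$ are inner products with induced norms $\|\cdot\|_k$, and there are constants $m,M>0$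 with $m\|\cdot\|^2\le\|\cdot\|_k^2\le M\|\cdot\|^2$ for all $k\ge0$. Algorithm (inexact SQA). Fix $\eta\in(0,1]$, $x_0\in\operatorname{dom}F$, and one of the line searches below. For $k=0,1,2,\dots$, let $Q_k(x):=\langle\nabla f(x_k),x-x_k\rangle+g(x)-g(x_k)+\frac12\|x-x_k\|_k^2$ and $Q_k^\ast:=\min_{x\in\mathcal{H}}Q_k(x)$. Choose any $\bar x_{k+1}$ with $Q_k(\bar x_{k+1})\le\eta\,(Q_k^\ast-Q_k(x_k))$ (note $Q_k(x_k)=0$), put $d_k:=\bar x_{k+1}-x_k$, determine $\alpha_k$ by the line search, and set $x_{k+1}:=x_k+\alpha_k d_k$. Line searches. In each case $\beta\in(0,1)$, $\bar\alpha\in(0,1]$, and $\alpha_k$ is the largest $\alpha\in\{\bar\alpha\beta^i: i=0,1,2,\dots\}$ satisfying: LS1 ($\gamma\in(0,1)$): $F(x_k+\alpha d_k)-F(x_k)\le\gamma\alpha\big(\langle\nabla f(x_k),d_k\rangle+g(\bar x_{k+1})-g(x_k)\big)$. LS2 ($\gamma\in(0,m/2)$): $\alpha\|\nabla f(x_k+\alpha d_k)-\nabla f(x_k)\|\le\gamma\|\alpha d_k\|$. LS3 ($\gamma\in(0,1)$): $F(x_k+\alpha d_k)-F(x_k)\le\alpha\big(\langle\nabla f(x_k),d_k\rangle+g(\bar x_{k+1})-g(x_k)+\frac{\gamma}{2}\|d_k\|_k^2\big)$. LS4 ($\gamma\in(0,1)$): $f(x_k+\alpha d_k)-f(x_k)\le\alpha\big(\langle\nabla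 f(x_k),d_k\rangle+\frac{\gamma}{2}\|d_k\|_k^2\big)$. *)

(* Defs.v *)
From HB Require Import structures.
From mathcomp Require Import all_boot all_order all_algebra.
From mathcomp Require Import all_classical all_reals all_analysis.

Set Implicit Arguments.
Unset Strict Implicit.
Unset Printing Implicit Defensive.

Import Order.TTheory GRing.Theory Num.Theory.
Import numFieldNormedType.Exports.

Local Open Scope classical_set_scope.
Local Open Scope ring_scope.

(* A real Hilbert space is a complete normed module [H] together with a form
   [ip : {dot H for idfun}] (bilinear, symmetric, positive definite) satisfying
   [hilbert_norm ip]. *)
Definition hilbert_norm (R : realType) (H : normedModType R)
    (ip : {dot H for idfun}) : Prop :=
  forall u : H, `|u| = Num.sqrt (ip u u).

Section extended_valued.
Variables (R : realType) (H : normedModType R).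
Implicit Types (h : H -> \bar R) (X : set H).
Local Open Scope ereal_scope.

Definition edom h : set H := [set x | h x < +oo].

Definition eproper h : Prop := (forall x, -oo < h x) /\ edom h !=set0.

Definition econvex h : Prop := forall (x y : H) (t : R), (0 < t < 1)%R ->
  h (t *: x + (1 - t) *: y)%R <= t%:E * h x + (1 - t)%:E * h y.

Definition minimizers h : set H := [set x | forall y, h x <= h y].

(* A minimum value is rendered by the infimum, which is the same number
   whenever the minimum is attained. *)
Definition emin h : \bar R := ereal_inf (range h).

Definition dist_to X (x : H) : R := inf [set `|x - y|%R | y in X].

(* The default value 0 is taken only when [x] has no nearest point in [X];
   this does not happen for [X] nonempty, closed and convex in a Hilbert
   space. *)
Definition metric_proj X (x : H) : H :=
  xget 0%R [set p | X p /\ forall q, X q -> (`|x - p| <= `|x - q|)%R].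

End extended_valued.

Section gradient.
Variables (R : realType) (H : normedModType R) (ip : {dot H for idfun}).
Implicit Types h : H -> \bar R.

(* The inclusion [U `<=` edom h] makes [fine \o h] coincide with [h] near each
   point of the open set [U], for [h] with values in ]-oo, +oo]. *)
Definition frechet_on (U : set H) h : Prop :=
  U `<=` edom h /\ forall x, U x -> differentiable (fine \o h : H -> R^o) x.

(* Riesz representative of the Frechet differential; in a Hilbert space it
   exists and is unique wherever [fine \o h] is differentiable. *)
Definition grad h (x : H) : H :=
  xget 0 [set v | forall u, ip v u = 'd (fine \o h : H -> R^o) x u].

End gradient.

Section metric.
Variables (R : realType) (H : normedModType R) (ip : {dot H for idfun}).
Variable A : {linear H -> H}.

Definition self_adjoint : Prop := forall u v, ip u (A v) = ip (A u) v.

Definition positive_op : Prop := forall u, u != 0 -> 0 < ip u (A u).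

Definition mnorm (u : H) : R := Num.sqrt (ip u (A u)).

End metric.

Definition objective (R : realType) (H : normedModType R) (f g : H -> \bar R)
    (y : H) : \bar R := (f y + g y)%E.

Variant line_search := LS1 | LS2 | LS3 | LS4.

Section algorithm.
Variables (R : realType) (H : normedModType R) (ip : {dot H for idfun}).
Variables f g : H -> \bar R.
Local Open Scope ereal_scope.

(* Here and below [z] is the current iterate, [zbar] the inexact minimizer,
   and [A] the operator of the current metric.  Subtracting [g z] is legitimate
   because the iterates stay in [edom g]. *)
Definition model (A : {linear H -> H}) (z y : H) : \bar R :=
  (ip (grad ip f z) (y - z)%R)%:E + g y - g z
  + ((mnorm ip A (y - z)%R) ^+ 2 / 2)%:E.

Definition lin_decrease (z zbar : H) : \bar R :=
  (ip (grad ip f z) (zbar - z)%R)%:E + g zbar - g z.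

Definition ls_test (ls : line_search) (gamma : R) (A : {linear H -> H})
    (z zbar : H) (a : R) : Prop :=
  let F := objective f g in
  let d := (zbar - z)%R in
  let z' := (z + a *: d)%R in
  match ls with
  | LS1 => F z' - F z <= (gamma * a)%:E * lin_decrease z zbar
  | LS2 => (a * `|grad ip f z' - grad ip f z| <= gamma * `|a *: d|)%R
  | LS3 => F z' - F z <=
      a%:E * (lin_decrease z zbar + (gamma / 2 * (mnorm ip A d) ^+ 2)%:E)
  | LS4 => f z' - f z <=
      (a * (ip (grad ip f z) d + gamma / 2 * (mnorm ip A d) ^+ 2))%:E
  end.

Definition ls_param (ls : line_search) (m gamma : R) : Prop :=
  match ls with
  | LS2 => (0 < gamma < m / 2)%R
  | _ => (0 < gamma < 1)%R
  end.

Definition ls_stepsize (ls : line_search) (gamma abar beta : R)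
    (A : {linear H -> H}) (z zbar : H) (a : R) : Prop :=
  let S := [set b : R | (exists i : nat, b = (abar * beta ^+ i)%R)
                        /\ ls_test ls gamma A z zbar b] in
  S a /\ ubound S a.

Definition inexact_sqa (ls : line_search) (eta gamma abar beta : R)
    (A : nat -> {linear H -> H}) (x xbar : nat -> H) (alpha : nat -> R) : Prop :=
  edom (objective f g) (x 0%N) /\
  forall k : nat,
    [/\ model (A k) (x k) (xbar k.+1) <=
          eta%:E * (emin (model (A k) (x k)) - model (A k) (x k) (x k)),
        ls_stepsize ls gamma abar beta (A k) (x k) (xbar k.+1) (alpha k)
      & x k.+1 = (x k + alpha k *: (xbar k.+1 - x k))%R].

End algorithm.

(* Main.v *)
Require Import Defs.
From HB Require Import structures.
From mathcomp Require Import all_boot all_order all_algebra.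
From mathcomp Require Import all_classical all_reals all_analysis.
From mathcomp Require Import ring lra.

Import Order.TTheory GRing.Theory Num.Theory.
Import numFieldNormedType.Exports.

Local Open Scope classical_set_scope.
Local Open Scope ring_scope.

(** The theorem holds because one iteration decreases the gap
[delta_k = F x_k - F^*] by a multiple of [delta_k ^ 2].

Fix a minimizer [y].  Convexity of [g] and the gradient inequality for [f] at
[x_k] bound the quadratic model on the segment from [x_k] to [y]:
  [Q_k (x_k + t (y - x_k)) <= - t delta_k + t ^ 2 M |y - x_k| ^ 2 / 2]
([rmodel_segment_le]).  The inexact minimizer does at least [eta] times as well
as every such point ([inexact_minimizer]), and each line search turns a fixed
fraction of [alpha_k Q_k (xbar_{k+1})] into actual decrease
([line_search_decrease]).  If [B] bounds both [delta_k] and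
[M |y - x_k| ^ 2], then [t = delta_k / B] is an admissible choice and
  [delta_{k+1} <= delta_k - kappa / (2 B) delta_k ^ 2]
with [kappa] independent of [k] and [B] ([objective_recursion]).

Such a recursion forces [k delta_k <= 2 B / kappa] ([quadratic_recursion]).
Both claims are instances of it.  Finiteness of [R_0] gives one [B] that works
for all [k], hence the rate O(1/k).  If moreover the distance to the minimizers
tends to 0, every [B > 0] works from some index on, because [delta_k] tends to
0 by the first claim; restarting the recursion at that index gives
[limsup k delta_k <= 2 B / kappa] for every [B], which is the rate o(1/k).

Two facts on Hilbert spaces are needed to give the gradient and the projection
their meaning, since both are defined by choice with a default value: the Riesz
representation theorem makes the gradient represent the differential
([gradE]), and the existence of nearest points makes the projection of a point
a minimizer ([minimizers_projection]).  Riesz representation is itself deduced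
from nearest points. *)

(** * Nearest points and Riesz representation in Hilbert spaces *)

Section hilbert.
Set Implicit Arguments.
Unset Strict Implicit.
Variables (R : realType) (H : completeNormedModType R).
Variable ip : {dot H for idfun}.
Hypothesis ipN : hilbert_norm ip.
Implicit Types (u v w x y : H) (t : R).

Lemma ipC u v : ip u v = ip v u.
Proof. by rewrite (@hermitian_subproof _ _ _ _ ip) expr0 mul1r. Qed.

Lemma ipDr u v w : ip u (v + w) = ip u v + ip u w.
Proof. exact: linearDr. Qed.

Lemma ipNr u v : ip u (- v) = - ip u v.
Proof. exact: linearNr. Qed.

Lemma ipZr t u v : ip u (t *: v) = t * ip u v.
Proof. exact: linearZr_LR. Qed.

Lemma ipDl u v w : ip (v + w) u = ip v u + ip w u.
Proof. by rewrite ipC ipDr !(ipC u). Qed.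

Lemma ipNl u v : ip (- v) u = - ip v u.
Proof. by rewrite ipC ipNr (ipC u). Qed.

Lemma ipZl t u v : ip (t *: v) u = t * ip v u.
Proof. by rewrite ipC ipZr (ipC u). Qed.

Lemma ip0r u : ip u 0 = 0.
Proof. exact: linear0r. Qed.

Lemma ip0l u : ip 0 u = 0.
Proof. by rewrite ipC ip0r. Qed.

Definition ipE := (ipDr, ipDl, ipNr, ipNl, ipZr, ipZl).

Lemma ip_ge0 u : 0 <= ip u u.
Proof.
have [->|u0] := eqVneq u 0; last exact/ltW/(@neq0_dnorm_gt0 _ _ _ ip).
by rewrite ip0r.
Qed.

Lemma normsqE u : `|u| ^+ 2 = ip u u.
Proof. by rewrite ipN sqr_sqrtr// ip_ge0. Qed.

(** The Cauchy-Schwarz inequality, read off from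
[0 <= | |v| u - |u| v | ^ 2]. *)
Lemma ip_le_norm u v : ip u v <= `|u| * `|v|.
Proof.
have [->|v0] := eqVneq v 0.
  by rewrite normr0 mulr0 ip0r.
have v_gt0 : 0 < `|v| by rewrite normr_gt0.
have := ip_ge0 (`|v| *: u - `|u| *: v).
rewrite !ipE -!normsqE (ipC v u) => h.
have [->|u0] := eqVneq u 0.
  by rewrite normr0 mul0r ip0l.
have u_gt0 : 0 < `|u| by rewrite normr_gt0.
rewrite -(ler_pM2l (mulr_gt0 u_gt0 v_gt0)); lra.
Qed.

(** By the parallelogram identity, two points of [X] whose distances to [x]
are almost minimal are close to each other, because their midpoint is in [X]
and is not closer to [x] than the infimum.  Hence minimizing sequences are
Cauchy. *)
Lemma nearest_point (X : set H) x : X !=set0 -> closed X ->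
    (forall p q, X p -> X q -> X (2^-1 *: (p + q))) ->
  exists2 p, X p & forall q, X q -> `|x - p| <= `|x - q|.
Proof.
move=> [q0 Xq0] clX midX.
pose D : set R := [set `|x - y| | y in X].
have D0 : D !=set0 by exists `|x - q0|, q0.
have lbD : has_lbound D by exists 0 => _ [y _ <-].
have dle q : X q -> inf D <= `|x - q|.
  by move=> Xq; apply: ge_inf => //; exists q.
set d := inf D in dle.
have d_ge0 : 0 <= d by apply: lb_le_inf => // _ [y _ <-].
have ex n : exists u, X u /\ `|x - u| < d + n.+1%:R^-1.
  have /inf_adherent -/(_ _ (conj D0 lbD))[_ [u Xu <-] h] :
    0 < n.+1%:R^-1 :> R by rewrite invr_gt0.
  by exists u.
have [u uP] := choice ex.
have par p q e : X p -> X q -> `|x - p| <= d + e -> `|x - q| <= d + e ->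
    `|p - q| ^+ 2 <= 4 * e * (2 * d + e).
  move=> Xp Xq hp hq.
  have hm := dle _ (midX _ _ Xp Xq).
  have -> : `|p - q| ^+ 2 = 2 * `|x - p| ^+ 2 + 2 * `|x - q| ^+ 2
      - 4 * `|x - 2^-1 *: (p + q)| ^+ 2.
    by rewrite !normsqE !ipE (ipC q x) (ipC p x) (ipC q p); field.
  have : d ^+ 2 <= `|x - 2^-1 *: (p + q)| ^+ 2 by rewrite ler_pXn2r ?nnegrE.
  have : `|x - p| ^+ 2 <= (d + e) ^+ 2.
    by rewrite ler_pXn2r ?nnegrE// (le_trans _ hp).
  have : `|x - q| ^+ 2 <= (d + e) ^+ 2.
    by rewrite ler_pXn2r ?nnegrE// (le_trans _ hp).
  rewrite !expr2; lra.
have cu : cvg (u @ \oo).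
  apply/cauchy_cvgP/cauchy_exP => eps eps0.
  (* then 4 e (2 d + e) <= 4 e (2 d + 1) < eps ^+ 2 *)
  pose e := Num.min 1 (eps ^+ 2 / (8 * (2 * d + 1))).
  have den0 : 0 < 8 * (2 * d + 1) by lra.
  have e0 : 0 < e by rewrite lt_min ltr01 divr_gt0// exprn_gt0.
  have e1 : e <= 1 by rewrite ge_min lexx.
  have e2 : e * (8 * (2 * d + 1)) <= eps ^+ 2.
    by rewrite -ler_pdivlMr// ge_min lexx orbT.
  have [N _ hN] : \forall n \near \oo, n.+1%:R^-1 < e.
    exact: near_infty_natSinv_lt (PosNum e0).
  have h n : (N <= n)%N -> `|x - u n| <= d + e.
    move=> /hN /= hn; apply: ltW (lt_trans (uP n).2 _).
    by rewrite ltrD2l; exact: hn.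
  exists (u N); exists N => // n /= Nn.
  rewrite -ball_normE /=.
  rewrite -(@ltr_pXn2r _ 2)// ?nnegrE ?(ltW eps0)//.
  apply: le_lt_trans (par _ _ e (uP N).1 (uP n).1 (h _ (leqnn _)) (h _ Nn)) _.
  have : 0 < eps ^+ 2 by rewrite exprn_gt0.
  nra.
exists (lim (u @ \oo)).
  by apply: (closed_cvg _ clX _ _ cu) => //; apply: nearW => n; exact: (uP n).1.
move=> q /dle; apply: le_trans; apply/ler_addgt0Pr => e e0.
have : u @ \oo --> lim (u @ \oo) by [].
move=> /cvgrPdist_lt /(_ (e / 2)) hu.
have {}hu := hu (divr_gt0 e0 (ltr0n _ 2)).
have h2 : \forall n \near \oo, n.+1%:R^-1 < e / 2.
  exact: near_infty_natSinv_lt (PosNum (divr_gt0 e0 (ltr0n R 2))).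
near \oo => n.
have h3 : `|lim (u @ \oo) - u n| < e / 2 by near: n.
have h4 : n.+1%:R^-1 < e / 2 by near: n.
rewrite -(subrK (u n) x) -addrA (le_trans (ler_normD _ _))//.
rewrite (distrC (u n)); have := (uP n).2; move: h3 h4.
move: (n.+1%:R^-1) => r; rewrite -/d; lra.
Unshelve. all: by end_near. Qed.

(** The point [p] of the hyperplane [L = 1] nearest to 0 is orthogonal to the
kernel of [L], so that [p / |p| ^ 2] represents [L]. *)
Lemma riesz (L : {linear H -> R^o}) : continuous L ->
  exists v, forall u, ip v u = L u.
Proof.
move=> cL.
have [L0|/existsNP[w Lw]] := pselect (forall u, L u = 0).
  by exists 0 => u; rewrite L0 ip0l.
have {}Lw : L w != 0 by apply/eqP.
pose X : set H := [set u | L u = 1].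
have [||p q Xp Xq|p Xp pmin] := @nearest_point X 0.
- by exists ((L w)^-1 *: w); rewrite /X/= linearZ; exact: mulVf.
- have -> : X = L @^-1` [set 1 : R^o] by [].
  by apply: closed_comp => // y _; exact: cL.
- rewrite /X/= linearZ linearD/= Xp Xq.
  by change (2^-1 * (1 + 1) = 1 :> R); field.
have orth k : L k = 0 -> ip p k = 0.
  move=> Lk.
  have key t : 0 <= 2 * t * ip p k + t ^+ 2 * ip k k.
    have := pmin (p + t *: k); rewrite !sub0r !normrN => /(_ _) h.
    have {}h : `|p| <= `|p + t *: k|.
      by apply: h; rewrite /X /= linearD linearZ/= Lk scaler0 addr0.
    have : `|p| ^+ 2 <= `|p + t *: k| ^+ 2 by rewrite ler_pXn2r ?nnegrE.
    rewrite !normsqE !ipE (ipC k p); lra.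
  have kk := ip_ge0 k; set b := ip k k in kk key; set a := ip p k in key *.
  (* the parabola in t has its minimum at - a / b; replacing b by b + 1 covers
     b = 0 and still gives a negative value unless a = 0 *)
  have /= := key (- a / (b + 1)).
  have b1 : 0 < b + 1 by lra.
  have -> : 2 * (- a / (b + 1)) * a + (- a / (b + 1)) ^+ 2 * b =
     - (a ^+ 2 * ((b + 2) / (b + 1) ^+ 2)) by field; lra.
  rewrite oppr_ge0 pmulr_lle0; last by rewrite divr_gt0 ?exprn_gt0//; lra.
  by move=> h; apply/eqP; rewrite -sqrf_eq0 eq_le h sqr_ge0.
have p0 : p != 0.
  apply/eqP => p0; move: Xp; rewrite /X/= p0 linear0 => /esym/eqP.
  by rewrite oner_eq0.
have pp : ip p p != 0 by rewrite gt_eqF// (@neq0_dnorm_gt0 _ _ _ ip).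
exists ((ip p p)^-1 *: p) => u.
have /orth : L (u - L u *: p) = 0.
  rewrite linearB linearZ/= Xp; change (L u - L u * 1 = 0 :> R).
  by rewrite mulr1 subrr.
rewrite !ipE => /eqP; rewrite subr_eq0 => /eqP ->.
by rewrite mulrCA mulVf// mulr1.
Qed.

End hilbert.

(** * The scalar recursion *)

Section recursion.
Set Implicit Arguments.
Unset Strict Implicit.
Variable R : realFieldType.

(** The sequence [s_n = q a_n] satisfies [s_{n+1} <= s_n (1 - s_n)].  If
[n s_n <= 1] then [(n + 1) s_n (1 - s_n) <= (1 - s_n) + s_n (1 - s_n)], which
equals [1 - s_n ^ 2]. *)
Lemma quadratic_recursion (a : nat -> R) (q : R) : 0 <= q ->
    (forall n, 0 <= a n) -> (forall n, a n.+1 <= a n - q * a n ^+ 2) ->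
  forall n, n%:R * (q * a n) <= 1.
Proof.
move=> q0 a0 arec; elim=> [|n IHn]; first by rewrite mul0r.
set s := q * a n in IHn.
have hs : q * a n.+1 <= s * (1 - s).
  have := ler_wpM2l q0 (arec n); rewrite /s expr2; lra.
have s0 : 0 <= s * (1 - s) by apply: le_trans hs; rewrite mulr_ge0.
have sge0 : 0 <= s by rewrite mulr_ge0.
have s1 : 0 <= 1 - s.
  have [->|sn0] := eqVneq s 0; first by rewrite subr0.
  by rewrite -(pmulr_rge0 _ (_ : 0 < s))// lt_neqAle eq_sym sn0.
rewrite -natr1; have n0 : 0 <= n%:R :> R by [].
apply: (@le_trans _ _ ((n%:R + 1) * (s * (1 - s)))).
  by rewrite ler_wpM2l// addr_ge0.
have := ler_wpM2r s1 IHn; have := sqr_ge0 s; rewrite expr2; lra.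
Qed.

End recursion.

(** * Convex extended-valued functions *)

Section convexity.
Set Implicit Arguments.
Unset Strict Implicit.
Variables (R : realType) (H : completeNormedModType R).
Implicit Types (h f g : H -> \bar R) (x y z : H) (t : R).

Lemma edom_fineK h x : (forall y, -oo < h y)%E -> edom h x ->
  h x = (fine (h x))%:E.
Proof. by move=> hN hx; rewrite fineK// fin_numElt hN. Qed.

(** Convexity in terms of real values.  Segments are parametrized from [z],
as the steps of the algorithm are, and the end points are included. *)
Lemma econvex_segment h z y t : (forall y, -oo < h y)%E -> econvex h ->
    edom h z -> edom h y -> 0 <= t <= 1 ->
  edom h (z + t *: (y - z)) /\
  fine (h (z + t *: (y - z))) <= fine (h z) + t * (fine (h y) - fine (h z)).
Proof.
move=> hN hc hz hy /andP[t0 t1].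
have [->|tn0] := eqVneq t 0; first by rewrite scale0r addr0 mul0r addr0.
have [->|tn1] := eqVneq t 1.
  by rewrite scale1r mul1r addrC subrK addrC subrK.
have /hc : 0 < t < 1 by rewrite !lt_neqAle eq_sym tn0 t0 tn1.
move=> /(_ y z); have -> : t *: y + (1 - t) *: z = z + t *: (y - z).
  by rewrite scalerBl scale1r scalerBr addrCA.
rewrite (edom_fineK hN hz) (edom_fineK hN hy) -!EFinM -EFinD => le.
have hd : edom h (z + t *: (y - z)) by apply: le_lt_trans le _; rewrite ltry.
split=> //; move: le; rewrite {1}(edom_fineK hN hd) lee_fin /=; lra.
Qed.

Lemma lower_semicontinuousD f g : (forall y, -oo < f y)%E ->
    (forall y, -oo < g y)%E -> lower_semicontinuous f ->
  lower_semicontinuous g -> lower_semicontinuous (objective f g).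
Proof.
move=> fN gN fl gl x c cfg.
(* c is split into a strict lower bound for each summand; a summand equal to
   +oo leaves complete freedom for its share *)
have [a [b [af bg cab]]] : exists a b,
    [/\ a%:E < f x, b%:E < g x & (c = a + b)%R]%E.
  move: cfg (fN x) (gN x); rewrite /objective.
  case: (f x) => [u| |]// ; case: (g x) => [v| |]// + _ _.
  - rewrite -EFinD lte_fin => h.
    exists (u - (u + v - c) / 2), (v - (u + v - c) / 2).
    by split; rewrite ?lte_fin; lra.
  - move=> _; exists (u - 1), (c - (u - 1)).
    by rewrite lte_fin ltry; split=> //; lra.
  - move=> _; exists (c - (v - 1)), (v - 1).
    by rewrite lte_fin ltry; split=> //; lra.
  - by move=> _; exists 0, c; rewrite !ltry; split=> //; lra.
have [V Vx fV] := fl _ _ af; have [W Wx gW] := gl _ _ bg.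
exists (V `&` W); first exact: filterI.
by move=> y [/fV fy /gW gy]; rewrite cab EFinD; exact: lteD.
Qed.

Lemma minimizers_edom f g : (forall z, -oo < f z)%E ->
    (forall z, -oo < g z)%E -> edom g `<=` edom f -> edom g !=set0 ->
  forall p, minimizers (objective f g) p -> edom f p /\ edom g p.
Proof.
move=> fN gN gf [g0 gg0] p Xp; have : (objective f g p < +oo)%E.
  apply: le_lt_trans (Xp g0) _; rewrite /objective.
  by rewrite lte_add_pinfty//; exact: gf.
rewrite /objective /edom /=; move: (fN p) (gN p).
by case: (f p) (g p) => [u| |]// [v| |].
Qed.

Variable ip : {dot H for idfun}.
Hypothesis ipN : hilbert_norm ip.

(** Riesz representation rules out the default value of [grad]. *)
Lemma gradE f x : differentiable (fine \o f : H -> R^o) x ->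
  forall u, ip (grad ip f x) u = 'd (fine \o f : H -> R^o) x u.
Proof.
move=> df; have [v hv] := riesz ipN (diff_continuous df).
exact: (@xgetI _ 0
  [set v | forall u, ip v u = 'd (fine \o f : H -> R^o) x u] v hv).
Qed.

(** By convexity the difference quotients of [f] at [x] along [y - x] are at
most [f y - f x] for all step lengths in ]0, 1], and so is their limit at 0. *)
Lemma grad_le f x y : (forall y, -oo < f y)%E -> econvex f ->
    differentiable (fine \o f : H -> R^o) x -> edom f x -> edom f y ->
  ip (grad ip f x) (y - x) <= fine (f y) - fine (f x).
Proof.
move=> fN fc df fx fy; rewrite gradE// -deriveE//.
have hD : h^-1 *: ((fine \o f \o shift x) (h *: (y - x)) - fine (f x))
    @[h --> 0^'] --> 'D_(y - x) (fine \o f : H -> R^o) x.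
  exact: (@diff_derivable _ _ _ _ x (y - x) df).
have {}hD := cvg_dnbhs_at_right hD.
rewrite -(cvg_lim _ hD)//; apply: limr_le.
  by apply/cvg_ex; eexists; exact: hD.
near=> h.
have h0 : 0 < h by near: h; exact: nbhs_right_gt.
have h1 : h <= 1 by near: h; apply: nbhs_right_le; exact: ltr01.
have [|_] := @econvex_segment f x y h fN fc fx fy; first by rewrite (ltW h0).
rewrite /= (addrC _ x) => le; rewrite [_ *: _]mulrC ler_pdivrMr//.
lra.
Unshelve. all: by end_near. Qed.

(** The set of minimizers is a sublevel set of a convex lower semicontinuous
function, hence closed and convex; thus nearest points in it exist and the
default value of [metric_proj] is not taken. *)
Lemma minimizers_projection f g y : (forall z, -oo < f z)%E ->
    (forall z, -oo < g z)%E -> lower_semicontinuous f ->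
    lower_semicontinuous g -> econvex f -> econvex g ->
    edom g `<=` edom f -> edom g !=set0 ->
    minimizers (objective f g) !=set0 ->
  minimizers (objective f g) (metric_proj (minimizers (objective f g)) y).
Proof.
move=> fN gN fl gl fc gc gf [g0 gg0] [z Xz].
set X := minimizers _.
have domX := minimizers_edom fN gN gf (ex_intro _ g0 gg0); rewrite -/X in domX.
have [fz gz] := domX _ Xz.
have XE : X = ~` [set p | (fine (f z) + fine (g z))%:E < objective f g p]%E.
  rewrite EFinD -(edom_fineK fN fz) -(edom_fineK gN gz).
  apply/seteqP; split=> p /=.
    by move=> Xp; apply/negP; rewrite -leNgt; exact: Xp.
  by move=> /negP; rewrite -leNgt => pz q; exact: le_trans pz (Xz q).
have [||p Xp pmin] := @nearest_point R H ip ipN X y (ex_intro _ z Xz).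
- rewrite XE; apply: open_closedC.
  exact: ((lower_semicontinuousP _).1 (lower_semicontinuousD fN gN fl gl)).
- move=> p q Xp Xq t.
  have [fp gp] := domX _ Xp; have [fq gq] := domX _ Xq.
  have -> : 2^-1 *: (p + q) = p + 2^-1 *: (q - p).
    rewrite scalerBr scalerDr addrCA [in RHS]addrC; congr (_ + _).
    rewrite -[X in _ = X - _]scale1r -scalerBl; congr (_ *: _); by field.
  have h01 : 0 <= (2^-1 : R) <= 1 by apply/andP; split; lra.
  have [fd fle] := econvex_segment fN fc fp fq h01.
  have [gd gle] := econvex_segment gN gc gp gq h01.
  refine (le_trans _ (Xp t)); have := Xq p; rewrite /objective.
  rewrite (edom_fineK fN fd) (edom_fineK gN gd) (edom_fineK fN fp).
  rewrite (edom_fineK gN gp) (edom_fineK fN fq) (edom_fineK gN gq).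
  rewrite -!EFinD !lee_fin; lra.
rewrite /metric_proj.
by have [] := @xgetI _ 0
  [set p | X p /\ forall q, X q -> `|y - p| <= `|y - q|] p (conj Xp pmin).
Qed.

End convexity.

(** * One iteration of the algorithm *)

Section one_iteration.
Set Implicit Arguments.
Unset Strict Implicit.
Variables (R : realType) (H : completeNormedModType R).
Variable ip : {dot H for idfun}.
Hypothesis ipN : hilbert_norm ip.
Variables f g : H -> \bar R.
Hypotheses (fN : forall y, (-oo < f y)%E) (gN : forall y, (-oo < g y)%E).
Hypotheses (fc : econvex f) (gc : econvex g) (gf : edom g `<=` edom f).
Hypothesis df : forall x, edom g x -> differentiable (fine \o f : H -> R^o) x.
Variable A : {linear H -> H}.
Implicit Types (x y z d : H) (t a : R).

(** [rmodel] and [robjective] are the real values of the model and of the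
objective on [edom g], where both are finite and where all iterates lie. *)
Definition rmodel z y : R := ip (grad ip f z) (y - z) + fine (g y) - fine (g z)
  + mnorm ip A (y - z) ^+ 2 / 2.

Definition robjective y : R := fine (f y) + fine (g y).

Lemma objectiveE y : edom g y -> objective f g y = (robjective y)%:E.
Proof.
move=> gy; rewrite /objective /robjective EFinD.
by rewrite -(edom_fineK gN gy) -(edom_fineK fN (gf gy)).
Qed.

Lemma modelE z y : edom g z -> edom g y ->
  model ip f g A z y = (rmodel z y)%:E.
Proof.
move=> gz gy; rewrite /model (edom_fineK gN gz) (edom_fineK gN gy).
by rewrite -!EFinD.
Qed.

Lemma mnormZ t d : mnorm ip A (t *: d) ^+ 2 = t ^+ 2 * mnorm ip A d ^+ 2.
Proof.
rewrite /mnorm linearZ/= (ipZr ip) (ipZl ip) mulrA -expr2 sqrtrM ?sqr_ge0//.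
by rewrite sqrtr_sqr exprMn real_normK ?num_real.
Qed.

Lemma rmodel_self z : rmodel z z = 0.
Proof.
have := mnormZ 0 (z - z); rewrite scale0r expr0n mul0r => mz.
by rewrite /rmodel subrr (ip0r ip) add0r subrr mz mul0r addr0.
Qed.

(** The point [y = z] shows that the model is finite at [zbar].  The comparison
with an arbitrary [y] holds because the infimum of the model is below its value
at [y]. *)
Lemma inexact_minimizer eta z zbar : 0 < eta -> edom g z ->
    (model ip f g A z zbar <=
       eta%:E * (emin (model ip f g A z) - model ip f g A z z))%E ->
  edom g zbar /\ forall y, edom g y -> rmodel z zbar <= eta * rmodel z y.
Proof.
move=> eta0 gz; rewrite (modelE gz gz) rmodel_self sube0 => le.
have {}le y : edom g y -> (model ip f g A z zbar <= (eta * rmodel z y)%:E)%E.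
  move=> gy; apply: (le_trans le); rewrite EFinM -modelE//.
  apply: lee_wpmul2l; first by rewrite lee_fin ltW.
  by apply: ereal_inf_lbound; exists y.
have gzb : edom g zbar.
  have := le _ gz; rewrite /model (edom_fineK gN gz) /edom /=.
  by move: (gN zbar); case: (g zbar) => // r; rewrite ltry.
by split=> // y /le; rewrite modelE// lee_fin.
Qed.

(** The linear part of the model decreases by at least [t] times the gap
between [z] and [y]: convexity handles [g], and the gradient inequality at [z]
handles [f]. *)
Lemma rmodel_segment_le (M : R) z y t : edom g z -> edom g y -> 0 <= t <= 1 ->
    mnorm ip A (y - z) ^+ 2 <= M * `|y - z| ^+ 2 ->
  edom g (z + t *: (y - z)) /\
  rmodel z (z + t *: (y - z)) <= - t * (robjective z - robjective y)
     + t ^+ 2 * (M * `|y - z| ^+ 2) / 2.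
Proof.
move=> gz gy t01 hM.
have [gd gle] := econvex_segment gN gc gz gy t01.
split=> //; move/andP: t01 => [t0 t1].
have fle := grad_le ipN fN fc (df gz) (gf gz) (gf gy).
have zt : z + t *: (y - z) - z = t *: (y - z) by rewrite addrC addKr.
rewrite /rmodel /robjective zt mnormZ (ipZr ip).
have := ler_wpM2l t0 fle; have := ler_wpM2l (sqr_ge0 t) hM; lra.
Qed.

(** Only the Armijo-type test of the first rule compares the actual decrease
with a proper fraction of the predicted one. *)
Definition ls_fraction (ls : line_search) (gamma : R) : R :=
  if ls is LS1 then gamma else 1.

Lemma ls_fraction_gt0 ls m gamma : ls_param ls m gamma ->
  0 < ls_fraction ls gamma.
Proof. by case: ls => //= /andP[]. Qed.

(** A sufficient decrease of [f] alone is enough because convexity bounds the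
change of [g] along the step; as [gamma <= 1], the quadratic term is at most
the one in the model.  The fourth rule is this test, and the second
implies it. *)
Lemma smooth_test_decrease z zbar gamma a : edom g z -> edom g zbar ->
    0 < a <= 1 -> gamma <= 1 ->
    fine (f (z + a *: (zbar - z))) - fine (f z) <=
      a * (ip (grad ip f z) (zbar - z)
           + gamma / 2 * mnorm ip A (zbar - z) ^+ 2) ->
  robjective (z + a *: (zbar - z)) - robjective z <= a * rmodel z zbar.
Proof.
move=> gz gzb /andP[a0 a1] gamma1 h.
have a01 : 0 <= a <= 1 by rewrite ltW.
have [_ gle] := econvex_segment gN gc gz gzb a01.
rewrite /robjective /rmodel.
have : a * (gamma / 2 * mnorm ip A (zbar - z) ^+ 2) <=
       a * (mnorm ip A (zbar - z) ^+ 2 / 2).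
  rewrite ler_pM2l// [leRHS]mulrC ler_wpM2r ?sqr_ge0//; lra.
lra.
Qed.

(** The first and third rules bound the decrease of the objective by terms
that are at most the model value up to the factor [ls_fraction].  For the second
rule, the gradient inequality at the new point [z'] gives
  [f z' - f z <= a <grad f z', d>],
and the test together with the Cauchy-Schwarz inequality allows replacing
[grad f z'] by [grad f z] at the cost [a gamma |d| ^ 2], which is at most
[a (2 gamma / m) / 2] times the squared metric norm of [d]; here
[2 gamma / m < 1]. *)
Lemma line_search_decrease ls m M gamma z zbar a : 0 < m ->
    (forall u : H, m * `|u| ^+ 2 <= mnorm ip A u ^+ 2 <= M * `|u| ^+ 2) ->
    ls_param ls m gamma -> edom g z -> edom g zbar -> 0 < a <= 1 ->
    ls_test ip f g ls gamma A z zbar a ->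
  robjective (z + a *: (zbar - z)) - robjective z <=
    ls_fraction ls gamma * a * rmodel z zbar.
Proof.
move=> m0 mM hgamma gz gzb a01.
have a01' : 0 <= a <= 1 by case/andP: a01 => /ltW ->.
have [gd _] := econvex_segment gN gc gz gzb a01'.
set d := zbar - z in gd *; set z' := z + a *: d in gd *.
have n0 : 0 <= mnorm ip A d ^+ 2 by rewrite sqr_ge0.
case/andP: (a01) => a0 a1.
case: ls hgamma => /= /andP[gam0 gam1]; rewrite ?mul1r.
- rewrite !objectiveE// /lin_decrease (edom_fineK gN gz) (edom_fineK gN gzb).
  rewrite -!EFinD -EFinM lee_fin -/z' -/d => /le_trans; apply.
  rewrite ler_pM2l ?mulr_gt0// /rmodel -/d; lra.
- rewrite -/z' -/d normrZ (gtr0_norm a0) mulrCA ler_pM2l// => gle.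
  apply: (@smooth_test_decrease _ _ (2 * gamma / m)) => //.
    rewrite ler_pdivrMr//; lra.
  have := grad_le ipN fN fc (df gd) (gf gd) (gf gz).
  rewrite -/z' -/d; have -> : z - z' = - (a *: d) by rewrite /z' opprD addNKr.
  rewrite (ipNr ip) (ipZr ip) => h1.
  have h2 : ip (grad ip f z') d - ip (grad ip f z) d <= gamma * `|d| ^+ 2.
    rewrite -(ipNl ip) -(ipDl ip); apply: le_trans (ip_le_norm ipN _ _) _.
    by rewrite expr2 mulrA ler_wpM2r.
  have /andP[h3 _] := mM d.
  have h4 : gamma * `|d| ^+ 2 <= 2 * gamma / m / 2 * mnorm ip A d ^+ 2.
    have -> : 2 * gamma / m / 2 = gamma / m by field; rewrite gt_eqF.
    by rewrite -mulrA ler_pM2l// ler_pdivlMl.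
  have := ler_wpM2l (ltW a0) (le_trans h2 h4); lra.
- rewrite !objectiveE// /lin_decrease (edom_fineK gN gz) (edom_fineK gN gzb).
  rewrite -!EFinD -EFinM lee_fin -/z' -/d => /le_trans; apply.
  rewrite ler_pM2l// /rmodel -/d lerD2l [leRHS]mulrC ler_wpM2r//; lra.
- rewrite (edom_fineK fN (gf gz)) (edom_fineK fN (gf gd)) -EFinD lee_fin => h.
  exact: (smooth_test_decrease gz gzb a01 (ltW gam1) h).
Qed.

(** The gain [D ^ 2 / (2 B)] is the value of [t D - t ^ 2 B / 2] at its
maximizer [t = D / B], which lies in [0, 1] because [D <= B]. *)
Lemma objective_recursion ls m M gamma eta amin a B z zbar y : 0 < m ->
    (forall u : H, m * `|u| ^+ 2 <= mnorm ip A u ^+ 2 <= M * `|u| ^+ 2) ->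
    ls_param ls m gamma -> 0 < eta -> 0 < amin -> amin <= a <= 1 ->
    edom g z -> edom g y ->
    (model ip f g A z zbar <=
       eta%:E * (emin (model ip f g A z) - model ip f g A z z))%E ->
    ls_test ip f g ls gamma A z zbar a ->
    0 < B -> M * `|y - z| ^+ 2 <= B ->
    0 <= robjective z - robjective y <= B ->
  robjective (z + a *: (zbar - z)) - robjective y <=
    (robjective z - robjective y)
    - ls_fraction ls gamma * amin * eta / (2 * B)
      * (robjective z - robjective y) ^+ 2.
Proof.
move=> m0 mM hgamma eta0 amin0 /andP[amina a1] gz gy hmin htest B0 hB.
set D := robjective z - robjective y => /andP[D0 DB].
have a0 : 0 < a by apply: lt_le_trans amina.
have [gzb le] := inexact_minimizer eta0 gz hmin.
have a01' : 0 < a <= 1 by rewrite a0.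
have dec := line_search_decrease m0 mM hgamma gz gzb a01' htest.
have q0 : rmodel z zbar <= 0.
  by have := le z gz; rewrite rmodel_self mulr0.
have t01 : 0 <= D / B <= 1 by rewrite divr_ge0 ?(ltW B0)// ler_pdivrMr// mul1r.
have [gt tle] := rmodel_segment_le gz gy t01 (proj2 (andP (mM (y - z)))).
have {}tle : rmodel z (z + (D / B) *: (y - z)) <= - (D ^+ 2 / (2 * B)).
  apply: (le_trans tle); rewrite -/D.
  have := ler_wpM2l (sqr_ge0 (D / B)) hB.
  have -> : (D / B) ^+ 2 * B = D ^+ 2 / B by field; rewrite gt_eqF.
  have -> : - (D / B) * D = - (D ^+ 2 / B) by field; rewrite gt_eqF.
  have -> : D ^+ 2 / (2 * B) = D ^+ 2 / B / 2 by field; rewrite gt_eqF.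
  lra.
have c0 := ls_fraction_gt0 hgamma; set c := ls_fraction _ _ in dec c0 *.
have h1 : c * a * rmodel z zbar <= c * amin * rmodel z zbar.
  by rewrite ler_wnM2r// ler_pM2l.
have h2 : rmodel z zbar <= eta * - (D ^+ 2 / (2 * B)).
  by apply: le_trans (le _ gt) _; rewrite ler_pM2l.
have := ler_wpM2l (mulr_ge0 (ltW c0) (ltW amin0)) h2.
have -> : c * amin * (eta * - (D ^+ 2 / (2 * B))) =
  - (c * amin * eta / (2 * B) * D ^+ 2) by field; rewrite gt_eqF.
move: dec h1; rewrite /D; lra.
Qed.

End one_iteration.

(** * From the recursion to the rates *)

(** In this section [delta] is the gap of the objective, and [close k B] stands
for the existence of a minimizer [y] with [M |y - x_k| ^ 2 <= B]. *)
Section rates.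
Set Implicit Arguments.
Unset Strict Implicit.
Variables (R : realType) (delta : nat -> R) (close : nat -> R -> Prop).
Variable kappa : R.
Hypotheses (kappa_gt0 : 0 < kappa) (delta_ge0 : forall k, 0 <= delta k).
Hypothesis delta_rec : forall k B, 0 < B -> delta k <= B -> close k B ->
  delta k.+1 <= delta k - kappa / (2 * B) * delta k ^+ 2.

Lemma rate_from N B : 0 < B ->
    (forall n, (N <= n)%N -> delta n <= B /\ close n B) ->
  forall n, n%:R * delta (N + n)%N <= 2 * B / kappa.
Proof.
move=> B0 NB n.
have q0 : 0 <= kappa / (2 * B) by rewrite divr_ge0// ?ltW// mulr_gt0.
have := @quadratic_recursion R (fun n => delta (N + n)%N) _ q0.
move=> /(_ _ _ n) h.
rewrite ler_pdivlMr// -[leRHS]mulr1 mulrC -ler_pdivrMl ?mulr_gt0//.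
apply: le_trans (h _ _) => [| |k]; first by lra.
  by move=> k; exact: delta_ge0.
have [dB closeB] := NB _ (leq_addr k N).
by rewrite addnS; exact: delta_rec.
Qed.

Section bounded.
Variable B : R.
Hypotheses (B_gt0 : 0 < B) (dclose : forall k, delta k <= B /\ close k B).

Let rate0 k : k%:R * delta k <= 2 * B / kappa.
Proof. exact: (@rate_from 0). Qed.

Lemma rate_bigO : (delta : nat -> R^o) =O_\oo (fun k : nat => k%:R^-1 : R^o).
Proof.
apply/eqO_exP; exists (2 * B / kappa); first by rewrite divr_gt0// mulr_gt0.
near=> k.
have k0 : 0 < k%:R :> R by rewrite ltr0n; near: k; exact: nbhs_infty_gt.
have : delta k <= 2 * B / kappa / k%:R.
  by rewrite ler_pdivlMr// mulrC; exact: rate0.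
by rewrite !ger0_norm// invr_ge0 ltW.
Unshelve. all: by end_near. Qed.

(** For a given [eps], the bound [e] makes the constant [2 e / kappa] of the
recursion equal to [eps / 2]; the remaining factor 2 absorbs the restart at
[N], since [k <= 2 (k - N)] once [k >= 2 N]. *)
Lemma rate_littleo : (forall e, 0 < e -> \forall k \near \oo, close k e) ->
  (delta : nat -> R^o) =o_\oo (fun k : nat => k%:R^-1 : R^o).
Proof.
move=> close_small; apply/eqoP => eps eps0.
pose e := eps * kappa / 4.
have e0 : 0 < e by rewrite divr_gt0// mulr_gt0.
have [N1 _ hN1] := close_small _ e0.
have [N2 _ hN2] := nbhs_infty_ger (2 * B / kappa / e).
pose N := (maxn N1 N2.+1).
have hN n : (N <= n)%N -> delta n <= e /\ close n e.
  rewrite geq_max => /andP[n1 n2]; split; last exact: hN1.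
  have n0 : 0 < n%:R :> R by rewrite ltr0n (leq_trans _ n2).
  rewrite -(ler_pM2l n0); apply: le_trans (rate0 n) _.
  by rewrite -ler_pdivrMr//; apply: hN2; exact: ltnW.
near=> k.
have k2 : (2 * N <= k)%N by near: k; exact: nbhs_infty_ge.
have k0 : 0 < k%:R :> R by rewrite ltr0n; near: k; exact: nbhs_infty_gt.
suff : delta k <= eps / k%:R by rewrite !ger0_norm// invr_ge0 ltW.
rewrite ler_pdivlMr// mulrC.
have Nk : (N <= k)%N by apply: leq_trans k2; rewrite leq_pmull.
have := rate_from e0 hN (k - N); rewrite subnKC// => h.
have h2 : k%:R <= 2 * (k - N)%:R :> R.
  rewrite -natrM ler_nat -{1}(subnK Nk) mul2n -addnn leq_add2l.
  by rewrite leq_subRL// addnn -mul2n.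
have := ler_wpM2r (delta_ge0 k) h2.
have -> : eps = 2 * (2 * e / kappa) by rewrite /e; field; rewrite gt_eqF.
by move=> /le_trans; apply; rewrite -[leLHS]mulrA ler_pM2l.
Unshelve. all: by end_near. Qed.

End bounded.
End rates.

(** * The convergence rates *)

Theorem theorem2 (R : realType) (H : completeNormedModType R)
    (ip : {dot H for idfun}) (f g : H -> \bar R)
    (A : nat -> {linear H -> H}) (m M eta gamma abar beta : R)
    (ls : line_search) (x xbar : nat -> H) (alpha : nat -> R) :
  let F := objective f g in let X := minimizers F in
  hilbert_norm ip ->
  eproper f -> lower_semicontinuous f -> econvex f ->
  eproper g -> lower_semicontinuous g -> econvex g ->
  edom g `<=` (edom f)° ->
  (exists U : set H, [/\ open U, edom g `<=` U & frechet_on U f]) ->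
  {within edom g, continuous (grad ip f)} ->
  X !=set0 -> emin F \is a fin_num ->
  (forall k, self_adjoint ip (A k)) ->
  (forall k, positive_op ip (A k)) ->
  0 < m -> 0 < M ->
  (forall k (u : H), m * `|u| ^+ 2 <= mnorm ip (A k) u ^+ 2 <= M * `|u| ^+ 2) ->
  0 < eta <= 1 -> 0 < beta < 1 -> 0 < abar <= 1 -> ls_param ls m gamma ->
  inexact_sqa ip f g ls eta gamma abar beta A x xbar alpha ->
  (exists2 amin : R, 0 < amin & forall k, amin <= alpha k) ->
  ereal_sup [set `|y - metric_proj X y|%:E | y in [set y | (F y <= F (x 0%N))%E]]
    \is a fin_num ->
  ((fun k : nat => fine (F (x k) - emin F)%E : R^o)
     =O_\oo (fun k : nat => k%:R^-1 : R^o)) /\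
  ((fun k : nat => dist_to X (x k)) @ \oo --> 0 ->
   (fun k : nat => fine (F (x k) - emin F)%E : R^o)
     =o_\oo (fun k : nat => k%:R^-1 : R^o)).
Proof.
move=> F X ipN [fN _] fl fc [gN gp] gl gc gif [U [_ gU [_ Udf]]] _ [p Xp] _ _ _
  m0 M0 mM /andP[eta0 _] /andP[beta0 beta1] /andP[abar0 abar1] hgamma [Fx0 it]
  [amin amin0 hamin] R0fin.
have gf : edom g `<=` edom f by move=> y /gif/interior_subset.
have df y : edom g y -> differentiable (fine \o f : H -> R^o) y.
  by move=> /gU/Udf.
have domX := minimizers_edom fN gN gf gp.
have gx k : edom g (x k).
  elim: k => [|k gk].
    by move: Fx0 (fN (x 0)) (gN (x 0)); rewrite /edom /objective /=;
      case: (f (x 0)) (g (x 0)) => [u| |]// [v| |].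
  have [hmin [[[i ai] _] _] ->] := it k.
  have [gzb _] := inexact_minimizer gN eta0 gk hmin.
  have [] // := econvex_segment gN gc gk gzb (t := alpha k) _.
  rewrite (le_trans (ltW amin0) (hamin k)) ai.
  by rewrite mulr_ile1 ?exprn_ge0 ?exprn_ile1// ltW.
have gXP q : X q -> edom g q by move=> /domX[].
pose Fr := robjective f g.
have FE y : edom g y -> F y = (Fr y)%:E by exact: objectiveE.
have eminE : emin F = (Fr p)%:E.
  rewrite -(FE _ (gXP _ Xp)); apply/le_anti/andP; split.
    by apply: ereal_inf_lbound; exists p.
  by apply: le_ereal_inf_tmp => _ [y _ <-]; exact: Xp.
pose delta k := Fr (x k) - Fr p.
have -> : (fun k => fine (F (x k) - emin F)%E : R^o) = (delta : nat -> R^o).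
  by apply/funext => k; rewrite eminE FE// -EFinB.
have Xeq q : X q -> Fr q = Fr p.
  move=> Xq; apply/eqP; rewrite eq_le -!lee_fin.
  rewrite -(FE _ (gXP _ Xp)) -(FE _ (gXP _ Xq)).
  by rewrite (Xp q) (Xq p).
have d0 k : 0 <= delta k.
  by rewrite subr_ge0 -lee_fin -(FE _ (gXP _ Xp)) -FE//; exact: Xp.
pose close k B := exists2 q, X q & M * `|q - x k| ^+ 2 <= B.
pose kappa := ls_fraction ls gamma * amin * eta.
have kappa0 : 0 < kappa by rewrite !mulr_gt0// (ls_fraction_gt0 hgamma).
have rec k B : 0 < B -> delta k <= B -> close k B ->
    delta k.+1 <= delta k - kappa / (2 * B) * delta k ^+ 2.
  move=> B0 dB [q Xq qB].
  have [hmin [[[i ai] htest] _] xS] := it k.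
  have ak : amin <= alpha k <= 1.
    rewrite hamin ai.
    by rewrite mulr_ile1 ?exprn_ge0 ?exprn_ile1// ltW.
  have := @objective_recursion R H ip ipN f g fN gN fc gc gf df (A k) ls m M
    gamma eta amin (alpha k) B (x k) (xbar k.+1) q m0 (mM k) hgamma eta0 amin0
    ak (gx k) (gXP _ Xq) hmin htest B0 qB.
  by rewrite -xS -/Fr (Xeq _ Xq) -/(delta k) -/(delta k.+1) d0 dB; exact.
have mono k : delta k <= delta 0.
  elim: k => // k; apply: le_trans.
  (* any bound for the gap and the distance yields monotonicity *)
  pose B := 1 + delta k + M * `|p - x k| ^+ 2.
  have Mp : 0 <= M * `|p - x k| ^+ 2 by rewrite mulr_ge0 ?exprn_ge0// ltW.
  have dk := d0 k.
  have B0 : 0 < B by rewrite /B; lra.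
  have := rec k B B0; rewrite {1}/B => h.
  apply: le_trans (h _ _) _.
  - lra.
  - by exists p => //; rewrite /B; lra.
  - by rewrite lerBlDr lerDl mulr_ge0 ?sqr_ge0// divr_ge0 ?ltW// mulr_gt0.
pose R0 := fine (ereal_sup
  [set `|y - metric_proj X y|%:E | y in [set y | (F y <= F (x 0%N))%E]]).
have R0P k : `|metric_proj X (x k) - x k| <= R0.
  rewrite distrC -lee_fin fineK//; apply: ereal_sup_ubound; exists (x k) => //=.
  by rewrite !FE// lee_fin; have := mono k; rewrite /delta lerD2r.
have projX y : X (metric_proj X y).
  by apply: minimizers_projection => //; exists p.
pose B := 1 + delta 0 + M * R0 ^+ 2.
have MR0 : 0 <= M * R0 ^+ 2 by rewrite mulr_ge0 ?sqr_ge0// ltW.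
have B0 : 0 < B by have := d0 0; rewrite /B; lra.
have dclose k : delta k <= B /\ close k B.
  split; first by have := mono k; rewrite /B; lra.
  exists (metric_proj X (x k)) => //.
  apply: (@le_trans _ _ (M * R0 ^+ 2)); last by have := d0 0; rewrite /B; lra.
  by rewrite ler_pM2l// lerXn2r ?nnegrE ?(le_trans _ (R0P k)).
split; first exact (rate_bigO kappa0 d0 rec B0 dclose).
move=> distX; apply: (rate_littleo kappa0 d0 rec B0 dclose) => e e0.
have s0 : 0 < Num.sqrt (e / M) by rewrite sqrtr_gt0 divr_gt0.
move/cvgrPdist_lt : distX => /(_ _ s0); apply: filterS => k.
rewrite sub0r normrN => /(le_lt_trans (ler_norm _)) hk.
have hinf : has_inf [set `|x k - y| | y in X].
  by split; [exists `|x k - p|, p | exists 0 => _ [y _ <-]].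
have h1 : 0 < Num.sqrt (e / M) - dist_to X (x k) by rewrite subr_gt0.
have [_ [q Xq <-]] := inf_adherent h1 hinf.
have -> : inf [set `|x k - y| | y in X] = dist_to X (x k) by [].
rewrite subrKC => hq.
exists q => //; rewrite mulrC -ler_pdivlMr//.
rewrite distrC -[leRHS]sqr_sqrtr; last by rewrite divr_ge0 ?ltW.
by rewrite lerXn2r ?nnegrE ?sqrtr_ge0// ltW.
Qed.
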